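(* Let $r$ be a nonnegative integer, let $A$ be a real $m\times n$ matrix, and let an edge-handling technique (extension or cropping, as described in the context) be given, yielding the matrix $A'$ associated with $A$. In the case of cropping assume $m,n\ge 2r+1$. Then $$G_{2r+1} * A = 4^{-2r}\,\sigma^{2r}(A'),$$ where $G_{2r+1}*A$ denotes the result of applying the kernel matrix $G_{2r+1}$ to $A$ with the chosen edge-handling technique.
   Context: Collapsing sum: for a real $M\times N$ matrix $B=(b_{i,j})$ with $M\ge 2$, $\sigma_{\downarrow}(B)$ is the $(M-1)\times N$ matrix with entries $\sigma_{\downarrow}(B)_{i,j}=b_{i,j}+b_{i+1,j}$; if $N\ge 2$, $\sigma_{\rightarrow}(B)$ is the $M\times(N-1)$ matrix with entries $\sigma_{\rightarrow}(B)_{i,j}=b_{i,j}+b_{i,j+1}$. Put $\sigma=\sigma_{\downarrow}\circ\sigma_{\rightarrow}=\sigma_{\rightarrow}\circ\sigma_{\downarrow}$, $\sigma^0(B)=B$, and $\sigma^s(B)=\sigma(\sigma^{s-1}(B))$ for $1\le s<\min\{M,N\}$. Gaussian kernel: $G_{2r+1}$ is the $(2r+1)\times(2r+1)$ matrix, indexed by $-r\le i,j\le r$ (so the central entry has coordinates $(0,0)$), with entries $(G_{2r+1})_{i,j}=\frac{1}{4^{2r}}\binom{2r}{i+r}\binom{2r}{j+r}$. Convolution: a kernel matrix $K=(k_{i,j})_{-r\le i,j\le r}$ is applied to a matrix by replacing the entry at position $(p,q)$ with $\sum_{i,j=-r}^{r}k_{i,j}\,a_{p-i,q-j}$. Edge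 handling: with cropping, the filter is applied only at those positions $(p,q)$ for which the convolution sum $\sum_{i,j=-r}^{r}k_{i,j}\,a_{p-i,q-j}$ involves only existing entries, and one sets $A'=A$. With extension, $A$ is extended by $r$ rows and $r$ columns on each side to an $(m+2r)\times(n+2r)$ matrix $A'$ (with arbitrary real values outside) whose central $m\times n$ block is $A$, and the filter is applied at each position of this central block. In both cases, applying the filter to $A$ with the chosen technique means applying it to $A'$ with cropping. Explicitly, if $A'=(a'_{i,j})$ is $M\times N$ (indexed from $(1,1)$), then, re-indexing the output from $(1,1)$, $K*A$ is the $(M-2r)\times(N-2r)$ matrix with entries $(K*A)_{p,q}=\sum_{i,j=-r}^{r}k_{i,j}\,a'_{p+r-i,\,q+r-j}$ for $1\le p\le M-2r$, $1\le q\le N-2r$. *)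

(* Defs.v *)
From mathcomp Require Import all_boot all_order all_algebra.
From mathcomp Require Import reals.

Set Implicit Arguments.
Unset Strict Implicit.
Unset Printing Implicit Defensive.

Import GRing.Theory.
Local Open Scope ring_scope.

(* All matrices below are indexed from 0, rather than from 1 as on paper.     *)

Lemma ord_next_subproof (M : nat) (i : 'I_M.-1) : (i.+1 < M)%N.
Proof. by rewrite -ltn_predRL. Qed.

Definition ord_here (M : nat) (i : 'I_M.-1) : 'I_M := widen_ord (leq_pred M) i.
Definition ord_next (M : nat) (i : 'I_M.-1) : 'I_M :=
  Ordinal (ord_next_subproof i).

Definition sigma_down (R : realType) (M N : nat) (B : 'M[R]_(M, N)) :
    'M[R]_(M.-1, N) :=
  \matrix_(i, j) (B (ord_here i) j + B (ord_next i) j).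

Definition sigma_right (R : realType) (M N : nat) (B : 'M[R]_(M, N)) :
    'M[R]_(M, N.-1) :=
  \matrix_(i, j) (B i (ord_here j) + B i (ord_next j)).

Definition sigma (R : realType) (M N : nat) (B : 'M[R]_(M, N)) :
    'M[R]_(M.-1, N.-1) :=
  sigma_down (sigma_right B).

Lemma sigmaC (R : realType) (M N : nat) (B : 'M[R]_(M, N)) :
  sigma_down (sigma_right B) = sigma_right (sigma_down B).
Proof. by apply/matrixP => i j; rewrite !mxE addrACA. Qed.

(* The casts only identify M - 0 with M and (M - s).-1 with M - s.+1. The     *)
(* definition is meaningful for s < minn M N; otherwise the result is empty.  *)
Fixpoint sigma_pow (R : realType) (M N : nat) (s : nat) (B : 'M[R]_(M, N)) :
    'M[R]_(M - s, N - s) :=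
  match s with
  | 0 => castmx (esym (subn0 M), esym (subn0 N)) B
  | t.+1 => castmx (esym (subnS M t), esym (subnS N t)) (sigma (sigma_pow t B))
  end.

(* A kernel (k_{i,j}) with -r <= i, j <= r is stored with both indices        *)
(* shifted by r: its entry u v is k_{u-r, v-r}. In particular the binomials   *)
(* 'C(2r, i+r) of the Gaussian kernel become 'C(2r, u).                       *)
Definition gaussian_kernel (R : realType) (r : nat) : 'M[R]_((2 * r).+1) :=
  \matrix_(u, v) (4 ^- (2 * r) * 'C(2 * r, u)%:R * 'C(2 * r, v)%:R).

Lemma conv_ord_subproof (r M : nat) (p : 'I_(M - 2 * r)) (u : 'I_(2 * r).+1) :
  (p + 2 * r - u < M)%N.
Proof. by apply: leq_ltn_trans (leq_subr _ _) _; rewrite addnC -ltn_subRL. Qed.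

(* The position p + r - i with i = u - r, that is p + 2r - u.                 *)
Definition conv_ord (r M : nat) (p : 'I_(M - 2 * r)) (u : 'I_(2 * r).+1) :
  'I_M := Ordinal (conv_ord_subproof p u).

Definition convolve_crop (R : realType) (r M N : nat)
    (K : 'M[R]_((2 * r).+1)) (A' : 'M[R]_(M, N)) :
    'M[R]_(M - 2 * r, N - 2 * r) :=
  \matrix_(p, q) \sum_(u < (2 * r).+1) \sum_(v < (2 * r).+1)
    K u v * A' (conv_ord p u) (conv_ord q v).

Definition central_block (R : realType) (r m n : nat)
    (A' : 'M[R]_(r + m + r, r + n + r)) : 'M[R]_(m, n) :=
  \matrix_(i, j) A' (lshift r (rshift r i)) (lshift r (rshift r j)).

(* The values an extension puts outside the central block are unconstrained   *)
(* and may depend on the matrix that is extended.                             *)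
Variant edge_handling (R : realType) (r m n : nat) : Type :=
| Cropping
| Extension (ext : 'M[R]_(m, n) -> 'M[R]_(r + m + r, r + n + r))
            (_ : forall A, central_block (ext A) = A).

Section EdgeHandling.
Variables (R : realType) (r m n : nat).
Implicit Type e : edge_handling R r m n.

Definition is_cropping e : bool := if e is Cropping then true else false.

Definition edge_rows e : nat := if e is Cropping then m else r + m + r.
Definition edge_cols e : nat := if e is Cropping then n else r + n + r.

Definition edge_mx e (A : 'M[R]_(m, n)) : 'M[R]_(edge_rows e, edge_cols e) :=
  match e return 'M[R]_(edge_rows e, edge_cols e) with
  | Cropping => A
  | Extension ext _ => ext A
  end.

Definition apply_filter e (K : 'M[R]_((2 * r).+1)) (A : 'M[R]_(m, n)) :
    'M[R]_(edge_rows e - 2 * r, edge_cols e - 2 * r) :=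
  convolve_crop K (edge_mx e A).

End EdgeHandling.

(* Main.v *)
Require Import Defs.
From mathcomp Require Import all_boot all_order all_algebra reals.

(** Pascal's rule shows, by induction on [s], that [sigma ^ s] is the sum over
    [u, v <= s] of the entries at offset [(u, v)], with weight
    ['C(s, u) * 'C(s, v)]. The convolution runs through the same offsets
    backwards, which is harmless since ['C(2r, u) = 'C(2r, 2r - u)]. *)

Import GRing.Theory.

Local Open Scope ring_scope.

(** One collapsing step in one direction, seen as Pascal's rule on the weights. *)
Lemma sum_binS (V : nmodType) (s : nat) (h : nat -> V) :
  \sum_(u < s.+2) h u *+ 'C(s.+1, u)
    = \sum_(u < s.+1) (h u + h u.+1) *+ 'C(s, u).
Proof.
rewrite big_ord_recl bin0.
under eq_bigr => u _ do rewrite lift0 binS mulrnDr.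
rewrite big_split /= addrA.
under [RHS]eq_bigr => u _ do rewrite mulrnDl.
rewrite [RHS]big_split /=; congr (_ + _).
(* The surplus last term has weight ['C(s, s.+1) = 0]. *)
by rewrite big_ord_recr [in RHS]big_ord_recl /= bin_small // mulr0n addr0 bin0.
Qed.

(* Extending the matrix by 0 to all of nat * nat frees the index arithmetic
   from bound proofs. *)
Definition entry {V : nmodType} {M N : nat} (B : 'M[V]_(M, N)) (a b : nat) : V :=
  if insub a is Some i then if insub b is Some j then B i j else 0 else 0.

Lemma entryE (V : nmodType) (M N : nat) (B : 'M[V]_(M, N)) (i : 'I_M)
    (j : 'I_N) :
  B i j = entry B i j.
Proof. by rewrite /entry !valK. Qed.

Lemma sigma_powE (R : realType) (M N s : nat) (B : 'M[R]_(M, N))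
    (i : 'I_(M - s)) (j : 'I_(N - s)) :
  sigma_pow s B i j
    = \sum_(u < s.+1) (\sum_(v < s.+1) entry B (i + u) (j + v) *+ 'C(s, v))
        *+ 'C(s, u).
Proof.
elim: s i j => [|s IHs] i j /=.
  by rewrite castmxE !big_ord1 !addn0 !mulr1n entryE.
rewrite castmxE !mxE !IHs /= -!big_split /=.
(* Pascal's rule acts on the row offset, then on the column offset in rows [u] and [u.+1]; this
   produces the four entries that [sigma] adds. *)
rewrite (sum_binS _ _ (fun u =>
  \sum_(v < s.+2) entry B (i + u) (j + v) *+ 'C(s.+1, v))).
apply: eq_bigr => u _; rewrite -!mulrnDl; congr (_ *+ _).
rewrite (sum_binS _ _ (fun v => entry B (i + u) (j + v))).
rewrite (sum_binS _ _ (fun v => entry B (i + u.+1) (j + v))).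
rewrite -!big_split /=; apply: eq_bigr => v _.
by rewrite -!mulrnDl !addnS !addSn.
Qed.

(** [B] is arbitrary, so it can be [edge_mx e A] for either edge handling. *)
Lemma convolve_gaussian (R : realType) (r M N : nat) (B : 'M[R]_(M, N)) :
  convolve_crop (gaussian_kernel R r) B
    = 4 ^- (2 * r) *: sigma_pow (2 * r) B.
Proof.
apply/matrixP => p q; rewrite !mxE sigma_powE.
rewrite (reindex_inj rev_ord_inj) big_distrr /=; apply: eq_bigr => u _.
rewrite (reindex_inj rev_ord_inj) -sumrMnl big_distrr /=.
apply: eq_bigr => v _; rewrite !mxE entryE /= !subSS.
have [ur vr] : (u <= 2 * r)%N /\ (v <= 2 * r)%N.
  by split; rewrite -ltnS.
(* After the reversal the kernel index is [2 * r - w], so [conv_ord] lands at offset [w]; the bound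
   keeps the truncated subtraction exact. *)
have back k w : (w <= 2 * r)%N -> (k + 2 * r - (2 * r - w) = k + w)%N.
  by move=> wr; rewrite -addnBA ?leq_subr // subKn.
rewrite !bin_sub // !back //.
rewrite -!mulrA; congr (_ * _).
by rewrite mulrCA -mulrnA -[RHS]mulr_natl natrM mulrA.
Qed.

Theorem theorem3p12 (R : realType) (r m n : nat) (A : 'M[R]_(m, n))
    (e : edge_handling R r m n) (m_gt0 : (0 < m)%N) (n_gt0 : (0 < n)%N)
    (crop_size : is_cropping e ->
      (2 * r + 1 <= m)%N /\ (2 * r + 1 <= n)%N) :
  apply_filter e (gaussian_kernel R r) A
    = 4 ^- (2 * r) *: sigma_pow (2 * r) (edge_mx e A).
Proof. exact: convolve_gaussian. Qed.
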